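(* For every graph $G$ let $\mathcal O_G$ be some set of allowed outputs, and let $\mathcal A$ be an algorithm in the extended sublinear graph model with expected running time $o(n^2)$ on graphs with $n$ vertices, such that $P[\mathcal A(G)\in\mathcal O_G]\ge p$ for every graph $G$. Let $\mathcal A'$ be the algorithm obtained from $\mathcal A$ by replacing every uniform random edge query by an approximately uniform random edge query with $\epsilon=\frac1{n^2}$, that is, by an independent sample from a distribution $\mathcal D_G$ on the edge set $E$ of $G$ that is $\epsilon$-close (in total variation distance, not necessarily pointwise) to the uniform distribution on $E$. Then $$P[\mathcal A'(G)\in\mathcal O_G]\ \ge\ p-o(1),$$ where $o(1)$ denotes a quantity that depends only on the number $n$ of vertices of $G$ (and on $\mathcal A$) and tends to $0$ as $n\to\infty$.
   Context: Graphs are finite and have at least one edge; $n$ is the number of vertices. Extended sublinear graph model. A randomized algorithm accesses the input graph $G$ only via: uniform random vertex queries; degree queries; neighbor queries (given $v$ and $j$, return the $j$th neighbor of $v$, if it exists); and uniform random edge queries, each returning a fresh independent uniformly random edge of $G$. Each query takes (at least) one unit of time, so the expected number of random edge queries is at most the expected running time. ''Expected running time $o(n^2)$'' means that the maximum over all $n$-vertex graphs $G$ of the expected running time of $\mathcal A(G)$ is $o(n^2)$ as $n\to\infty$. Closeness. A distribution $\mathcal P$ is $\epsilon$-close to $\mathcal Q$ if $|\mathcal P-\mathcal Q|_{TV}=\frac12\sum_{\omega}|\mathcal P(\omega)-\mathcal Q(\omega)|\le\epsilon$. *)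

(* Defs.v *)
From HB Require Import structures.
From mathcomp Require Import all_boot all_order all_algebra.
From mathcomp Require Import all_classical all_reals all_analysis.
Import Order.TTheory GRing.Theory Num.Theory.
Import numFieldNormedType.Exports.

Set Implicit Arguments.
Unset Strict Implicit.
Unset Printing Implicit Defensive.

Local Open Scope classical_set_scope.
Local Open Scope ring_scope.

(* A simple undirected graph on the vertex set {0, ..., n-1} with at least one
   edge, given by its adjacency lists: the "j-th neighbour" of a vertex only
   makes sense relative to an ordering of its neighbours, and that ordering is
   arbitrary. *)
Record graph (n : nat) := Graph {
  nbrs : 'I_n -> seq 'I_n;
  nbrs_uniq : forall v, uniq (nbrs v);
  nbrs_irrefl : forall v, v \notin nbrs v;
  nbrs_sym : forall u v, (u \in nbrs v) = (v \in nbrs u);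
  nbrs_nonempty : exists v, nbrs v != [::]
}.

Definition edges (n : nat) (G : graph n) : {set {set 'I_n}} :=
  [set e : {set 'I_n} |
    [exists u, exists v, (v \in nbrs G u) && (e == [set u; v]%SET)]]%SET.

Definition is_distr (R : realType) (T : finType) (E : {set T}) (P : T -> R) :=
  [/\ forall x, 0 <= P x, forall x, x \notin E -> P x = 0
    & \sum_x P x = 1].

Definition uniform_distr (R : realType) (T : finType) (E : {set T}) : T -> R :=
  fun x => if x \in E then #|E|%:R^-1 else 0.

Definition tv_dist (R : realType) (T : finType) (P Q : T -> R) : R :=
  2^-1 * \sum_x `|P x - Q x|.

Definition eps_close (R : realType) (T : finType) (eps : R) (P Q : T -> R) : Prop :=
  tv_dist P Q <= eps.

(* What an algorithm may do in a state; S is the type of its states, and k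
   gives the next state as a function of the answer it receives. [Random mu k]
   is an internal random choice (no access to the graph); taking mu on nat
   covers every discrete source of randomness, in particular coin flips. *)
Inductive action (R : realType) (n : nat) (Out S : Type) :=
| Halt (o : Out)
| Random (mu : probability nat R) (k : nat -> S)
| VertexQuery (k : 'I_n -> S)
| DegreeQuery (v : 'I_n) (k : nat -> S)
| NeighborQuery (v : 'I_n) (j : nat) (k : option 'I_n -> S)
| EdgeQuery (k : {set 'I_n} -> S).
Arguments Halt {R n Out S}.
Arguments Random {R n Out S}.
Arguments VertexQuery {R n Out S}.
Arguments DegreeQuery {R n Out S}.
Arguments NeighborQuery {R n Out S}.
Arguments EdgeQuery {R n Out S}.

(* [cost s] is the time taken by the action performed in state s, including
   whatever deterministic computation produces the next state. Runs may be
   infinite. *)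
Record program (R : realType) (n : nat) (Out : Type) := Program {
  state : Type;
  init : state;
  step : state -> action R n Out state;
  cost : state -> nat;
  cost_gt0 : forall s, (0 < cost s)%N
}.

Section semantics.
Context {R : realType} {n : nat} {Out : Type}.
(* D is the distribution from which every edge query is answered. *)
Variables (G : graph n) (D : {set 'I_n} -> R).

Local Open Scope ereal_scope.

Definition average (T : finType) (P : T -> R) (f : T -> \bar R) : \bar R :=
  \sum_x (P x)%:E * f x.

(* Expectation of f at the next state, the answers being drawn independently of
   the past; 0 if there is no next state. *)
Definition next_mean (S : Type) (a : action R n Out S) (f : S -> \bar R) :
    \bar R :=
  match a with
  | Halt _ => 0
  | Random mu k => \int[mu]_i f (k i)
  | VertexQuery k => average (uniform_distr R [set: 'I_n]%SET) (fun v => f (k v))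
  | DegreeQuery v k => f (k (size (nbrs G v)))
  | NeighborQuery v j k => f (k (onth (nbrs G v) j))
  | EdgeQuery k => average D (fun e => f (k e))
  end.

Variable A : program R n Out.

(* Probability that a run from s halts within t actions with output in O. *)
Fixpoint output_prob_within (O : set Out) (t : nat) (s : state A) : \bar R :=
  if t is t'.+1 then
    match step s with
    | Halt o => (\1_O o)%:E
    | a => next_mean a (output_prob_within O t')
    end
  else 0.

(* Expected time of the first t actions of a run from s. *)
Fixpoint mean_time_within (t : nat) (s : state A) : \bar R :=
  if t is t'.+1 then
    (cost s)%:R%:E + next_mean (step s) (mean_time_within t')
  else 0.

(* Both quantities are nondecreasing in t, so the suprema are limits. *)
Definition output_prob (O : set Out) : \bar R :=
  ereal_sup (range (fun t => output_prob_within O t (init A))).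

Definition mean_time : \bar R :=
  ereal_sup (range (fun t => mean_time_within t (init A))).

End semantics.

(* The edge oracle of the extended sublinear graph model. *)
Definition uniform_edge (R : realType) (n : nat) (G : graph n) :
  {set 'I_n} -> R := uniform_distr R (edges G).

(* There are finitely many graphs on 'I_n, so this is a maximum (-oo if there
   is none, i.e. if n <= 1). *)
Definition max_mean_time (R : realType) (n : nat) (Out : Type)
    (A : program R n Out) : \bar R :=
  ereal_sup (range (fun G : graph n => mean_time G (uniform_edge R G) A)).

(* An algorithm knows the number n of vertices. *)
Definition algorithm (R : realType) (Out : Type) :=
  forall n, program R n Out.

Definition time_o_n2 (R : realType) (Out : Type) (A : algorithm R Out) : Prop :=
  (fun n => max_mean_time (A n) * ((n%:R ^+ 2)^-1)%:E)%E @ \oo --> 0%E.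

(* Main.v *)
(** A run makes at most as many edge queries as it takes time, and replacing the
answer of one query by an eps-close one lowers the probability of any event by
at most eps.  Hence the output probability drops by at most eps times the
expected running time with the uniform oracle; for eps = 1/n^2 this is o(1).
Without any coupling, this is the inequality
[P_U(t, s) <= P_D(t, s) + eps * T_U(t, s)] for truncated runs, by induction on t. *)
Require Import Defs.
From mathcomp Require Import all_boot all_order all_algebra.
From mathcomp Require Import all_classical all_reals all_analysis.
From mathcomp Require Import lra.
Import Order.TTheory GRing.Theory Num.Theory.
Import numFieldNormedType.Exports.
Local Open Scope classical_set_scope.
Local Open Scope ring_scope.

Section distributions.
Context {R : realType} {T : finType}.
Implicit Types (P Q : T -> R) (E : {set T}) (f g : T -> \bar R).

Lemma is_distr_uniform E : E != finset.set0 -> is_distr E (uniform_distr R E).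
Proof.
move=> E0; split=> [x|x /negPf xE|]; rewrite /uniform_distr.
- by case: ifP; rewrite // invr_ge0.
- by rewrite xE.
- rewrite -big_mkcond sumr_const -[LHS]mulr_natl divff//.
  by rewrite pnatr_eq0 cards_eq0.
Qed.

Local Open Scope ereal_scope.

Lemma average_ge0 P f : (forall x, (0 <= P x)%R) -> (forall x, 0 <= f x) ->
  0 <= average P f.
Proof. by move=> P0 f0; apply: sume_ge0 => x _; rewrite mule_ge0// lee_fin. Qed.

Lemma le_average P f g : (forall x, (0 <= P x)%R) -> (forall x, f x <= g x) ->
  average P f <= average P g.
Proof. by move=> P0 fg; apply: lee_sum => x _; rewrite lee_wpmul2l// lee_fin. Qed.

Lemma averageD P f g : (forall x, 0 <= f x) -> (forall x, 0 <= g x) ->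
  average P (fun x => f x + g x) = average P f + average P g.
Proof.
move=> f0 g0; rewrite /average -big_split; apply: eq_bigr => x _.
by rewrite ge0_muleDr.
Qed.

Lemma averageZ P f (r : R) : (forall x, (0 <= P x)%R) -> (forall x, 0 <= f x) ->
  average P (fun x => r%:E * f x) = r%:E * average P f.
Proof.
move=> P0 f0; rewrite /average ge0_sume_distrr => [|x _].
  by apply: eq_bigr => x _; rewrite muleCA.
by rewrite mule_ge0// lee_fin.
Qed.

Lemma average1 E P : is_distr E P -> average P (fun=> 1) = 1.
Proof.
case=> _ _ P1; rewrite /average -[RHS]/(1%R%:E) -[in RHS]P1 -sumEFin.
by apply: eq_bigr => x _; rewrite mule1.
Qed.

Lemma average_le_tv E P Q f :
  is_distr E P -> is_distr E Q -> (forall x, 0 <= f x <= 1) ->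
  average P f <= average Q f + (tv_dist Q P)%:E.
Proof.
move=> [_ _ P1] [_ _ Q1] f01.
pose h x := fine (f x).
have fh x : f x = (h x)%:E.
  have /andP[f0 f1] := f01 x; rewrite fineK// ge0_fin_numE//.
  exact: le_lt_trans f1 (ltry _).
have h01 x : (0 <= h x <= 1)%R by rewrite -!lee_fin -fh.
have avgE S : average S f = (\sum_x S x * h x)%:E.
  by rewrite -sumEFin; apply: eq_bigr => x _; rewrite fh.
rewrite !avgE -EFinD lee_fin -lerBlDl -sumrB /tv_dist.
(* Both total masses are 1, so [h] may be recentred at 1/2. *)
have -> : (\sum_x (P x * h x - Q x * h x) =
    \sum_x (P x - Q x) * (h x - 2^-1))%R.
  under [RHS]eq_bigr do rewrite mulrBr mulrBl.
  have PQ0 : (\sum_x (P x - Q x) = 0)%R by rewrite sumrB P1 Q1 subrr.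
  by rewrite [RHS]sumrB -mulr_suml PQ0 mul0r subr0.
rewrite mulr_sumr; apply: ler_sum => x _.
(* The bound [|h x - 1/2| <= 1/2] supplies exactly the factor 1/2 of [tv_dist]; using [|h x| <= 1]
   instead would lose a factor 2. *)
rewrite (le_trans (ler_norm _))// normrM mulrC (distrC (P x)) ler_wpM2r//.
have /andP[h0 h1] := h01 x.
by rewrite ler_norml; apply/andP; split; lra.
Qed.

End distributions.

Lemma edges_neq0 n (G : graph n) : edges G != finset.set0.
Proof.
have [u Gu] := nbrs_nonempty G.
case E: (nbrs G u) Gu => [//|v s] _.
apply/set0Pn; exists [set u; v]%SET; rewrite inE.
by apply/existsP; exists u; apply/existsP; exists v; rewrite E mem_head eqxx.
Qed.

(** [G] witnesses that ['I_n] is inhabited; for [n = 0] the total mass would be 0. *)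
Lemma is_distr_vertex {R : realType} n (G : graph n) :
  is_distr [set: 'I_n]%SET (uniform_distr R [set: 'I_n]%SET).
Proof.
have [u _] := nbrs_nonempty G.
by apply: is_distr_uniform; apply/set0Pn; exists u; rewrite inE.
Qed.

Section next_mean.
Context {R : realType} {n : nat} {Out S : Type}.
Variables (G : graph n) (D : {set 'I_n} -> R).
Hypothesis distrD : is_distr (edges G) D.
Implicit Types (a : action R n Out S) (f g : S -> \bar R).

Local Open Scope ereal_scope.

Let D0 e : (0 <= D e)%R. Proof. by case: distrD. Qed.

Let V0 v : (0 <= uniform_distr R [set: 'I_n]%SET v)%R.
Proof. by case: (@is_distr_vertex R _ G). Qed.

Lemma next_mean_ge0 a f : (forall s, 0 <= f s) -> 0 <= next_mean G D a f.
Proof.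
by move=> f0; case: a => //= *; [exact: integral_ge0| exact: average_ge0..].
Qed.

Lemma le_next_mean a f g : (forall s, 0 <= f s) -> (forall s, f s <= g s) ->
  next_mean G D a f <= next_mean G D a g.
Proof.
move=> f0 fg; case: a => //= *; [exact: ge0_le_integral| exact: le_average..].
Qed.

Lemma next_meanD a f g : (forall s, 0 <= f s) -> (forall s, 0 <= g s) ->
  next_mean G D a (fun s => f s + g s) = next_mean G D a f + next_mean G D a g.
Proof.
move=> f0 g0; case: a => /= *; rewrite ?adde0//.
(* Every function on [nat] is measurable, so additivity of the integral asks only for
   nonnegativity. *)
- exact: ge0_integralD.
- exact: averageD.
- exact: averageD.
Qed.

Lemma next_meanZ a f (r : R) : (0 <= r)%R -> (forall s, 0 <= f s) ->
  next_mean G D a (fun s => r%:E * f s) = r%:E * next_mean G D a f.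
Proof.
move=> r0 f0; case: a => /= *; rewrite ?mule0//.
- exact: ge0_integralZl_EFin.
- exact: averageZ.
- exact: averageZ.
Qed.

Lemma next_mean_le1 a f : (forall s, 0 <= f s <= 1) -> next_mean G D a f <= 1.
Proof.
move=> f01; have f0 s : 0 <= f s by case/andP: (f01 s).
have f1 s : f s <= 1 by case/andP: (f01 s).
(* The constant 1 has mean 1 except at [Halt], where [next_mean] is 0. *)
apply: le_trans (le_next_mean a f (fun=> 1) f0 f1) _.
case: a => /= *; rewrite ?lee01//.
- by rewrite integral_cst// mul1e probability_le1.
- by rewrite (average1 _ _ (is_distr_vertex _ G)).
- by rewrite (average1 _ _ distrD).
Qed.

End next_mean.

(** Only [EdgeQuery] consults the oracle; for every other action the two means coincide and
    [tv_dist D U >= 0] is enough. *)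
Lemma next_mean_le_tv {R : realType} n {Out S : Type} (G : graph n)
    (D U : {set 'I_n} -> R) (a : action R n Out S) (f : S -> \bar R) :
  is_distr (edges G) D -> is_distr (edges G) U -> (forall s, 0 <= f s <= 1)%E ->
  (next_mean G U a f <= next_mean G D a f + (tv_dist D U)%:E)%E.
Proof.
move=> hD hU f01.
have tv0 : 0 <= tv_dist D U by rewrite mulr_ge0// sumr_ge0.
case: a => [x|mu k|k|v k|v j k|k] /=; rewrite ?leeDl ?add0e ?lee_fin//.
exact: average_le_tv hU hD _.
Qed.

Section runs.
Context {R : realType} {n : nat} {Out : Type}.
Variables (G : graph n) (A : program R n Out).
Implicit Types (D U : {set 'I_n} -> R) (O : set Out) (s : state A).

Local Open Scope ereal_scope.

Lemma mean_time_within_ge0 D t s : is_distr (edges G) D ->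
  0 <= mean_time_within G D t s.
Proof.
move=> hD; elim: t s => //= t IH s.
by rewrite adde_ge0 ?lee_fin// next_mean_ge0.
Qed.

Lemma output_prob_within01 D O t s : is_distr (edges G) D ->
  0 <= output_prob_within G D O t s <= 1.
Proof.
move=> hD; elim: t s => [|t IH] s /=; first by rewrite lexx lee01.
have IH0 s' : 0 <= output_prob_within G D O t s' by case/andP: (IH s').
have := next_mean_le1 _ _ hD (step s) _ IH.
have := next_mean_ge0 _ _ hD (step s) _ IH0.
case: (step s) => [x _ _|||||]; try by move=> *; exact/andP.
by rewrite !lee_fin indicE ler0n lern1 leq_b1.
Qed.

(** The order of replacement matters: the rest of the run is switched to [D] while the current
    action is still answered by [U], and only then is the current action switched. The errors are
    thus averaged along [U]-runs, whose expected time is controlled; the time under [D] is not. *)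
Lemma output_prob_within_le D U O (eps : R) t s :
  is_distr (edges G) D -> is_distr (edges G) U -> eps_close eps D U ->
  output_prob_within G U O t s <=
    output_prob_within G D O t s + eps%:E * mean_time_within G U t s.
Proof.
move=> hD hU close.
have eps0 : (0 <= eps)%R by apply: le_trans close; rewrite mulr_ge0// sumr_ge0.
elim: t s => [|t IH] s /=; first by rewrite mule0 adde0.
set T := mean_time_within G U t.
set F := output_prob_within G D O t.
have T0 s' : 0 <= T s' by exact: mean_time_within_ge0.
have F01 s' : 0 <= F s' <= 1 by exact: output_prob_within01.
have F0 s' : 0 <= F s' by case/andP: (F01 s').
(* Stated through [next_mean] to treat all actions at once; [Halt], where the output probability is
   an indicator instead, is settled at the end. *)
have step_le : next_mean G U (step s) (output_prob_within G U O t) <=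
    next_mean G D (step s) F
    + eps%:E * ((cost s)%:R%:E + next_mean G U (step s) T).
  apply: le_trans (le_next_mean _ _ hU _ _ _ _ IH) _ => [s'|].
    by case/andP: (output_prob_within01 U O t s' hU).
  rewrite (next_meanD _ _ _ F (fun s' => eps%:E * T s'))//; last first.
    by move=> s'; rewrite mule_ge0// lee_fin.
  rewrite (next_meanZ _ _ hU)// ge0_muleDr ?lee_fin//; last exact: next_mean_ge0.
  (* Switching the current action loses at most [eps], which is paid for by its cost since
     [1 <= cost s]. *)
  rewrite addeA leeD2r// (le_trans (next_mean_le_tv _ _ _ _ _ _ hD hU F01))//.
  rewrite leeD2l// lee_fin (le_trans close)// ler_peMr//.
  by rewrite ler1n cost_gt0.
case: (step s) step_le => //= o _.
by rewrite adde0 leeDl// mule_ge0// lee_fin.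
Qed.

Lemma output_prob_ge0 D O : 0 <= output_prob G D A O.
Proof. by apply: ereal_sup_ubound; exists 0%N. Qed.

Lemma output_prob_le1 D O : is_distr (edges G) D -> output_prob G D A O <= 1.
Proof.
move=> hD; apply: ge_ereal_sup => _ [t _ <-].
by case/andP: (output_prob_within01 D O t (init A) hD).
Qed.

Lemma output_prob_le D U O (eps : R) :
  is_distr (edges G) D -> is_distr (edges G) U -> eps_close eps D U ->
  output_prob G U A O <= output_prob G D A O + eps%:E * mean_time G U A.
Proof.
move=> hD hU close; apply: ge_ereal_sup => _ [t _ <-].
have eps0 : (0 <= eps)%R by apply: le_trans close; rewrite mulr_ge0// sumr_ge0.
apply: le_trans (output_prob_within_le _ _ O eps t (init A) hD hU close) _.
apply: leeD; first by apply: ereal_sup_ubound; exists t.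
by rewrite lee_wpmul2l ?lee_fin//; apply: ereal_sup_ubound; exists t.
Qed.

End runs.

Theorem theorem8 (R : realType) (Out : Type) (A : algorithm R Out)
    (hA : time_o_n2 A) :
  exists2 delta : nat -> R, delta @ \oo --> (0 : R) &
    forall (O : forall n : nat, graph n -> set Out) (p : R),
      (forall (n : nat) (G : graph n),
        (p%:E <= output_prob G (uniform_edge R G) (A n) (O n G))%E) ->
      forall (n : nat) (G : graph n) (D : {set 'I_n} -> R),
        is_distr (edges G) D ->
        eps_close ((n%:R ^+ 2)^-1) D (uniform_edge R G) ->
        ((p - delta n)%:E <= output_prob G D (A n) (O n G))%E.
Proof.
pose x n := (max_mean_time (A n) * ((n%:R ^+ 2)^-1)%:E)%E.
(* The running time may be infinite for finitely many n, where the trivial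
   bound [p <= 1] is used. *)
exists (fun n => if x n \is a fin_num then fine (x n) else 1).
  (* A finite limit forces [x n] to be finite eventually, so the default value 1 does not affect the
     limit. *)
  have [xfin xcvg] := (fine_cvgP _ _).1 hA.
  apply: cvg_trans xcvg; apply: near_eq_cvg.
  by near=> n; rewrite /= ifT//; near: n.
move=> O p hp n G D hD close.
have hU : is_distr (edges G) (uniform_edge R G).
  exact: is_distr_uniform (edges_neq0 _ G).
case: ifPn => [xn|_]; last first.
  apply: le_trans (output_prob_ge0 _ _ _ _).
  by rewrite lee_fin subr_le0 -lee_fin (le_trans (hp n G))// output_prob_le1.
rewrite EFinB fineK// leeBlDr//.
apply: le_trans (hp n G) _.
apply: le_trans (output_prob_le _ _ _ _ _ _ hD hU close) _.
(* The time on this [G] is at most the maximum over all graphs on [n] vertices, so the loss is at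
   most [x n], uniformly in [G], [D], [O] and [p]. *)
rewrite leeD2l// muleC lee_wpmul2r ?lee_fin ?invr_ge0 ?exprn_ge0//.
by apply: ereal_sup_ubound; exists G.
Unshelve. all: by end_near. Qed.
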